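(* The predicted error reduction $\Delta e_{\mathbb{W},\mathbb{Y}}^2:=\|u_{\mathbb{X}}-u_{\mathbb{W}}\|_{\mathbb{X}}^2-\|u_{\mathbb{X}}-u_{\mathbb{Y}}\|_{\mathbb{X}}^2$ satisfies $$\Delta e_{\mathbb{W},\mathbb{Y}}^2=\|u_{\mathbb{Y}}-u_{\mathbb{W}}\|_{\mathbb{X}}^2-2\,\rho_{\mathbb{Y}}(u^{\mathrm{loc}}_{\mathbb{W}})=\rho_{\mathbb{W}}(y_\xi)-\rho_{\mathbb{Y}}(u^{\mathrm{loc}}_{\mathbb{W}}),$$ where $\rho_{\mathbb{W}}(\cdot):=b(\cdot)-a(u_{\mathbb{W}},\cdot)$ and $\rho_{\mathbb{Y}}(\cdot):=b(\cdot)-a(u_{\mathbb{Y}},\cdot)$.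
   Context: $\mathbb{X}$ is a real Hilbert space, $a:\mathbb{X}\times\mathbb{X}\to\mathbb{R}$ a bounded, symmetric, $\mathbb{X}$-elliptic bilinear form with induced norm $\|v\|_{\mathbb{X}}:=a(v,v)^{1/2}$, and $b:\mathbb{X}\to\mathbb{R}$ a bounded linear form. $u_{\mathbb{X}}\in\mathbb{X}$ is the solution of $a(u_{\mathbb{X}},v)=b(v)$ for all $v\in\mathbb{X}$. $\mathbb{W}\subseteq\mathbb{X}$ is a finite-dimensional subspace with basis $\phi_1,\dots,\phi_N$, and $u_{\mathbb{W}}\in\mathbb{W}$ solves $a(u_{\mathbb{W}},w)=b(w)$ for all $w\in\mathbb{W}$. For an index set $\mathcal{I}^{\mathrm{loc}}\subset\{1,\dots,N\}$ let $\mathbb{W}^{\mathrm{loc}}:=\operatorname{span}\{\phi_i:i\in\mathcal{I}^{\mathrm{loc}}\}$ and $\Pi^{\mathrm{loc}}:\mathbb{W}\to\mathbb{W}^{\mathrm{loc}}$, $\sum_{i=1}^Nv_i\phi_i\mapsto\sum_{i\in\mathcal{I}^{\mathrm{loc}}}v_i\phi_i$. Put $u^{\mathrm{loc}}_{\mathbb{W}}:=\Pi^{\mathrm{loc}}u_{\mathbb{W}}$ and $\widetilde u_{\mathbb{W}}:=u_{\mathbb{W}}-u^{\mathrm{loc}}_{\mathbb{W}}$. $\xi_1,\dots,\xi_L\in\mathbb{X}$ are linearly independent elements such that $\mathbb{Y}:=\operatorname{span}\{\widetilde u_{\mathbb{W}},\xi_1,\dots,\xi_L\}$ has dimension $L+1$.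 $u_{\mathbb{Y}}\in\mathbb{Y}$ solves $a(u_{\mathbb{Y}},v)=b(v)$ for all $v\in\mathbb{Y}$, and is written uniquely as $u_{\mathbb{Y}}=(1+\epsilon)\,\widetilde u_{\mathbb{W}}+y_\xi$ with $\epsilon\in\mathbb{R}$ and $y_\xi\in\operatorname{span}\{\xi_1,\dots,\xi_L\}$. *)

(* Defs.v *)
From HB Require Import structures.
From mathcomp Require Import all_boot all_order all_algebra.
From mathcomp Require Import sesquilinear.
From mathcomp Require Import boolp classical_sets reals topology normedtype.

Set Implicit Arguments.
Unset Strict Implicit.
Unset Printing Implicit Defensive.

Import Order.TTheory GRing.Theory Num.Theory.
Import numFieldNormedType.Exports.

Local Open Scope classical_set_scope.
Local Open Scope ring_scope.

HB.mixin Record NormedModule_isHilbert (R : realType) (X : Type)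
    of CompleteNormedModule R X := {
  inner : {dot X for idfun};
  hilbert_normE : forall x : X, `|x| = Num.sqrt (inner x x)
}.

#[short(type="hilbertType")]
HB.structure Definition Hilbert (R : realType) :=
  {X of CompleteNormedModule R X & NormedModule_isHilbert R X}.

Section LinearAlgebra.
Variables (R : realType) (X : lmodType R).
Implicit Types A W : set X.

Definition lin_span A : set X :=
  [set x | exists n (c : 'I_n -> R) (v : 'I_n -> X),
    (forall i, A (v i)) /\ x = \sum_(i < n) c i *: v i].

Definition lin_indep n (v : 'I_n -> X) : Prop :=
  forall c : 'I_n -> R, \sum_(i < n) c i *: v i = 0 -> forall i, c i = 0.

Definition is_basis n (v : 'I_n -> X) W : Prop :=
  lin_indep v /\ W = lin_span (range v).

Definition has_dim W n : Prop := exists v : 'I_n -> X, is_basis v W.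

(* The coefficients of x in the family v, chosen arbitrarily when they are not
   unique and equal to 0 when x is not in the span of v. *)
Definition coords n (v : 'I_n -> X) (x : X) : 'I_n -> R :=
  xget (fun=> 0) [set c : 'I_n -> R | x = \sum_(i < n) c i *: v i].

(* The map \sum_i v_i phi_i |-> \sum_(i in I) v_i phi_i on the span of phi; it
   takes the junk value 0 outside of this span. *)
Definition loc_proj n (phi : 'I_n -> X) (I : {set 'I_n}) (x : X) : X :=
  \sum_(i in I) coords phi x i *: phi i.

Lemma loc_projE n (phi : 'I_n -> X) (I : {set 'I_n}) (c : 'I_n -> R) :
  lin_indep phi ->
  loc_proj phi I (\sum_(i < n) c i *: phi i) = \sum_(i in I) c i *: phi i.
Proof.
move=> phi_free; rewrite /loc_proj /coords.
case: xgetP => [d _ /= cd|/(_ c)]; last by case.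
apply: eq_bigr => i _; congr (_ *: _).
apply/eqP; rewrite -subr_eq0; apply/eqP; move: i.
apply: (phi_free (fun i => d i - c i)).
under eq_bigr do rewrite scalerBl.
by rewrite sumrB -cd subrr.
Qed.

Lemma loc_proj_span n (phi : 'I_n -> X) (I : {set 'I_n}) (x : X) :
  lin_span (phi @` [set` I]) (loc_proj phi I x).
Proof.
exists #|I|, (fun k => coords phi x (enum_val k)), (phi \o enum_val); split.
  by move=> k; exists (enum_val k) => //=; exact: enum_valP.
by rewrite /loc_proj big_enum_val.
Qed.

End LinearAlgebra.

Section Forms.
Variables (R : realType) (X : normedModType R).

Definition bounded_form (b : X -> R) : Prop :=
  exists C : R, forall v, `|b v| <= C * `|v|.

Definition bounded_biform (a : X -> X -> R) : Prop :=
  exists C : R, forall u v, `|a u v| <= C * `|u| * `|v|.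

Definition elliptic (a : X -> X -> R) : Prop :=
  exists2 alpha : R, 0 < alpha & forall v, alpha * `|v| ^+ 2 <= a v v.

Definition energy_norm (a : X -> X -> R) (v : X) : R := Num.sqrt (a v v).

Definition galerkin_sol (a : X -> X -> R) (b : X -> R) (V : set X) (u : X) :=
  V u /\ forall v, V v -> a u v = b v.

Definition residual (a : X -> X -> R) (b : X -> R) (u v : X) : R :=
  b v - a u v.

Definition error_reduction (a : X -> X -> R) (uX uW uY : X) : R :=
  energy_norm a (uX - uW) ^+ 2 - energy_norm a (uX - uY) ^+ 2.

End Forms.

(* Main.v *)
Require Import Defs.
From HB Require Import structures.
From mathcomp Require Import all_boot all_order all_algebra.
From mathcomp Require Import sesquilinear.
From mathcomp Require Import boolp classical_sets reals topology normedtype.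
From mathcomp Require Import ring.

(** The idea: a Galerkin solution [u] is the [a]-orthogonal projection of [uX],
    so its squared error is [a uX uX - b u] (lemma [galerkin_error_sq]), and the
    error reduction is simply [b uY - b uW].  The spaces [W] and [Y] need
    not be nested, yet they share the vector [uWt = uW - uWloc]: it lies in [Y] as a
    generator, and in [W] because [uWloc] is a combination of basis vectors of
    [W].  Testing the equation of [uY] with [uWt] gives the mixed term
      [a uY uW = b uW - residual a b uY uWloc],
    which determines the squared energy norm of [uY - uW] (first equality).
    Testing the equation of [uW] with [uWt] shows that the residual of [uW] does
    not see the [uWt]-component of [uY], so that
      [residual a b uW yxi = residual a b uW uY],
    and the same mixed term yields the second equality. *)

Set Implicit Arguments.
Unset Strict Implicit.
Unset Printing Implicit Defensive.

Import Order.TTheory GRing.Theory Num.Theory.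
Import numFieldNormedType.Exports.

Local Open Scope classical_set_scope.
Local Open Scope ring_scope.

Section Span.
Variables (R : realType) (X : lmodType R).

Lemma mem_lin_span (A : set X) x : A x -> lin_span A x.
Proof.
move=> Ax; exists 1%N, (fun=> 1), (fun=> x).
by split => //; rewrite big_ord1 scale1r.
Qed.

Lemma lin_span_rangeP n (v : 'I_n -> X) x :
  lin_span (range v) x <-> exists c : 'I_n -> R, x = \sum_(i < n) c i *: v i.
Proof.
split=> [[m [c [w [wv ->]]]]|[c ->]]; last first.
  by exists n, c, v; split=> // i; exists i.
(* A vector [v i] may occur several times among the [w j]: its coefficient is
   the sum of the [c j] over the [j] assigned to the index [i]. *)
have /choice [f wE] j : exists i, w j = v i by have [i _ <-] := wv j; exists i.
exists (fun i => \sum_(j < m | f j == i) c j).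
under [RHS]eq_bigr do rewrite scaler_suml.
rewrite (partition_big f predT) //=.
apply: eq_bigr => i _; apply: eq_bigr => j /eqP fj.
by rewrite wE fj.
Qed.

Lemma sub_loc_proj_span n (phi : 'I_n -> X) (I : {set 'I_n}) x :
  lin_span (range phi) x -> lin_span (range phi) (x - loc_proj phi I x).
Proof.
move=> /lin_span_rangeP[c ->]; apply/lin_span_rangeP.
rewrite /loc_proj; set d := coords phi _.
exists (fun i => c i - (if i \in I then d i else 0)).
under [RHS]eq_bigr do rewrite scalerBl.
rewrite sumrB; congr (_ - _); rewrite big_mkcond /=.
by apply: eq_bigr => i _; case: ifP; rewrite ?scale0r.
Qed.

End Span.

Section Galerkin.
Variables (R : realType) (X : hilbertType R) (a : {symmetric X}).

Lemma symmetric_formC u v : a u v = a v u.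
Proof. by have := hermC a u v; rewrite expr0 mul1r. Qed.

Lemma energy_norm_sqB u v : elliptic a ->
  energy_norm a (u - v) ^+ 2 = a u u - 2 * a u v + a v v.
Proof.
move=> [alpha alpha_gt0 a_ge].
rewrite /energy_norm sqr_sqrtr; last first.
  by apply: le_trans (a_ge _); rewrite mulr_ge0 ?exprn_ge0 // ltW.
rewrite linearBl /= !linearBr /= (symmetric_formC v u); ring.
Qed.

(** The error is orthogonal to [u], hence the Pythagorean identity; the term
    [b u] is the squared energy norm of [u]. *)
Lemma galerkin_error_sq (b : X -> R) (V : set X) uX u : elliptic a ->
  galerkin_sol a b setT uX -> galerkin_sol a b V u ->
  energy_norm a (uX - u) ^+ 2 = a uX uX - b u.
Proof.
move=> a_ell [_ uXE] [Vu uE].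
rewrite energy_norm_sqB // (uXE u I) (uE u Vu); ring.
Qed.

End Galerkin.

Theorem theorem15 (R : realType) (X : hilbertType R)
  (a : {symmetric X}) (b : {scalar X})
  (a_bounded : bounded_biform a) (a_elliptic : elliptic a)
  (b_bounded : bounded_form b)
  (uX : X) (uX_sol : galerkin_sol a b setT uX)
  (W : set X) (N : nat) (phi : 'I_N -> X) (phi_basis : is_basis phi W)
  (uW : X) (uW_sol : galerkin_sol a b W uW)
  (Iloc : {set 'I_N})
  (uWloc : X) (uWlocE : uWloc = loc_proj phi Iloc uW)
  (uWt : X) (uWtE : uWt = uW - uWloc)
  (L : nat) (xi : 'I_L -> X) (xi_indep : lin_indep xi)
  (Y : set X) (YE : Y = lin_span (uWt |` range xi)) (Y_dim : has_dim Y L.+1)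
  (uY : X) (uY_sol : galerkin_sol a b Y uY)
  (eps : R) (yxi : X) (yxi_span : lin_span (range xi) yxi)
  (uYE : uY = (1 + eps) *: uWt + yxi) :
  error_reduction a uX uW uY
    = energy_norm a (uY - uW) ^+ 2 - 2 * residual a b uY uWloc
  /\
  energy_norm a (uY - uW) ^+ 2 - 2 * residual a b uY uWloc
    = residual a b uW yxi - residual a b uY uWloc.
Proof.
have WuWt : W uWt.
  case: phi_basis uW_sol => _ -> [WuW _].
  by rewrite uWtE uWlocE; exact: sub_loc_proj_span.
have YuWt : Y uWt by rewrite YE; apply: mem_lin_span; left.
have [WuW uW_eq] := uW_sol; have [YuY uY_eq] := uY_sol.
have auYuW : a uY uW = b uW - residual a b uY uWloc.
  have := uY_eq _ YuWt; rewrite uWtE linearBr linearB /= /residual => h.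
  by rewrite opprB addrCA -h addrCA subrr addr0.
have energyE : energy_norm a (uY - uW) ^+ 2
    = b uY - b uW + 2 * residual a b uY uWloc.
  rewrite energy_norm_sqB // auYuW (uY_eq _ YuY) (uW_eq _ WuW); ring.
have res_yxi : residual a b uW yxi = residual a b uW uY.
  rewrite /residual uYE linearD linearDr linearZ linearZr /= (uW_eq _ WuWt).
  by rewrite opprD addrACA subrr add0r.
split.
  rewrite /error_reduction (galerkin_error_sq a_elliptic uX_sol uW_sol).
  rewrite (galerkin_error_sq a_elliptic uX_sol uY_sol) energyE; ring.
rewrite energyE res_yxi [residual a b uW uY]/residual (symmetric_formC a uW uY).
rewrite auYuW; ring.
Qed.
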